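(* For every $M>0$ there is $N$ such that every finite poset $P$ with $\mathrm{gap}(P)\ge N$ satisfies $w(P)\ge M$.
   Context: For a finite poset $P$ with $n$ elements, $f$ is a uniformly random linear extension (order-preserving bijection $P\to\{1,\dots,n\}$) and $h(x)=\mathbb{E}f(x)$. Listing the elements as $x_1,\dots,x_n$ with $h(x_1)\le\cdots\le h(x_n)$, $\mathrm{gap}(P)=\max\{h(x_1),h(x_2)-h(x_1),\dots,h(x_n)-h(x_{n-1}),n+1-h(x_n)\}$. $w(P)$ is the width (maximum antichain size). *)

(* Defs.v *)
From HB Require Import structures.
From mathcomp Require Import all_boot all_order all_algebra.
From mathcomp Require Import reals.

Set Implicit Arguments.
Unset Strict Implicit.
Unset Printing Implicit Defensive.

Import Order.TTheory GRing.Theory Num.Theory.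
Local Open Scope ring_scope.

Section PosetGap.
Variables (d : Order.disp_t) (P : finPOrderType d).

(* A map into 'I_#|P| is a bijection iff it is injective; the label of x in
   {1, ..., n} is (f x).+1. *)
Definition linear_extensions : {set {ffun P -> 'I_#|P|}} :=
  [set f : {ffun P -> 'I_#|P|} |
    injectiveb f && [forall x, forall y, (x <= y)%O ==> (f x <= f y)%N]].

Definition antichain (A : {set P}) : bool :=
  [forall x in A, forall y in A, (x >=< y)%O ==> (x == y)].

Definition width : nat := \max_(A : {set P} | antichain A) #|A|.

Variable R : realType.

Definition height (x : P) : R :=
  (\sum_(f in linear_extensions) (f x).+1%:R) / #|linear_extensions|%:R.

Definition by_height : seq P :=
  sort (fun x y => height x <= height y) (enum P).

(* The successive differences of 0, h(x_1), ..., h(x_n), n + 1. *)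
Definition gaps : seq R :=
  pairmap (fun a b => b - a) 0
    (rcons [seq height x | x <- by_height] #|P|.+1%:R).

(* All the gaps are nonnegative, so the default value 0 does not affect the
   maximum. For the empty poset, gaps = [:: 1] and gap = 1. *)
Definition gap : R := \big[Num.max/0]_(g <- gaps) g.

End PosetGap.

Arguments linear_extensions {d} P.
Arguments width {d} P.
Arguments by_height {d} P R.
Arguments gaps {d} P R.
Arguments gap {d} P R.

(* Main.v *)
Require Import Defs.
From mathcomp Require Import all_boot all_order all_algebra.
From mathcomp Require Import reals.
From mathcomp Require Import zify ring lra.

Set Implicit Arguments.
Unset Strict Implicit.
Unset Printing Implicit Defensive.

Import Order.TTheory GRing.Theory Num.Theory.
Local Open Scope nat_scope.

(** Let [h] avoid the interval ]a, b[ with [b - a >= N], let [B] be the up-set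
   [{h >= b}] and let [S] consist of the maximal elements of the complement of
   [B] and the minimal elements of [B], so that [|S| <= 2 w(P)].  Replace linear
   extensions by the order-preserving maps [P -> {0, ..., m}], for [m] large.
   The number of those with prescribed values on [S] is a discretely
   log-concave function of these values and of [m] (four functions theorem on
   a product of chains, after a translation by one unit).  At a typical point,
   close to the mean, the values on [S] leave room to move [B] down by
   [2 t ~ N m / n]; log-concavity between [m] and [m - 2 t] together with AM-GM then
   gives at most [3^|S|] times as many maps into [{0, ..., m}] as into
   [{0, ..., m - t}].  Comparing with their true number, asymptotic to
   [e(P) m^n / n!] with [e(P)] the number of linear extensions, bounds [N] in
   terms of [|S|]. *)

(** * Four functions theorem on a power of a chain *)

(** Since [(c - a) * (c - b) >= 0], one has [c * (a + b) <= c * c + a * b <= c * (c + e)]; if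
    [c = 0], then [a] and [b] vanish too. *)
Lemma leq_add_of_prod (a b c e : nat) :
  a <= c -> b <= c -> a * b <= c * e -> a + b <= c + e.
Proof.
move=> ac bc; case: (posnP c) => [c0|c0 H]; first by lia.
rewrite -(leq_pmul2l c0) !mulnDr.
have : 0 <= (c - a) * (c - b) by []; nia.
Qed.

(* In the symmetrized double sum, the pair {x, y} contributes
   [f x g y + f y g x] on the left, which [leq_add_of_prod] bounds. *)
Lemma four_functions_chain (K : nat) (f g h k : 'I_K -> nat) :
  (forall x y z w : 'I_K, z = maxn x y :> nat -> w = minn x y :> nat ->
     f x * g y <= h z * k w) ->
  (\sum_x f x) * (\sum_y g y) <= (\sum_x h x) * (\sum_y k y).
Proof.
move=> H.
have E (u v : 'I_K -> nat) : 2 * ((\sum_x u x) * (\sum_y v y)) =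
    \sum_x \sum_y (u x * v y + u y * v x).
  rewrite mul2n -addnn {2}mulnC !big_distrlr /= -big_split /=.
  apply: eq_bigr => x _; rewrite -big_split /=.
  by apply: eq_bigr => y _; rewrite [v x * _]mulnC.
rewrite -(leq_pmul2l (isT : 0 < 2)) !E.
apply: leq_sum => x _; apply: leq_sum => y _.
wlog xy : x y / x <= y => [W|].
  case: (leqP x y) => [/W //|/ltnW /W].
  by rewrite addnC [h x * _ + _]addnC.
have Hd (z : 'I_K) : f z * g z <= h z * k z by apply: H; rewrite ?maxnn ?minnn.
have H1 : f x * g y <= h y * k x by apply: H; lia.
have H2 : f y * g x <= h y * k x by apply: H; lia.
rewrite [h x * _ + _]addnC; apply: leq_add_of_prod => //.
have := leq_mul (Hd x) (Hd y); lia.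
Qed.

(** Induction on the list [D] of free coordinates, the maps being fixed outside [D]. Freeing one
    more coordinate splits each sum by the value taken there, and the chain inequality applies to
    these partial sums. *)
Lemma four_functions (P : finType) (K : nat) (f g h k : {ffun P -> 'I_K} -> nat) :
  (forall X Y Z W : {ffun P -> 'I_K},
     (forall i, Z i = maxn (X i) (Y i) :> nat) ->
     (forall i, W i = minn (X i) (Y i) :> nat) -> f X * g Y <= h Z * k W) ->
  (\sum_X f X) * (\sum_Y g Y) <= (\sum_X h X) * (\sum_Y k Y).
Proof.
move=> H.
pose agree (D : seq P) (u X : {ffun P -> 'I_K}) :=
  [forall x, (x \notin D) ==> (X x == u x)].
pose upd (u : {ffun P -> 'I_K}) (i : P) (t : 'I_K) :=
  [ffun x => if x == i then t else u x].
suff main (D : seq P) : uniq D -> forall u v z w : {ffun P -> 'I_K},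
     (forall i, z i = maxn (u i) (v i) :> nat) ->
     (forall i, w i = minn (u i) (v i) :> nat) ->
  (\sum_(X | agree D u X) f X) * (\sum_(X | agree D v X) g X) <=
  (\sum_(X | agree D z X) h X) * (\sum_(X | agree D w X) k X).
  (* Without any map to serve as base point, the sums are empty. *)
  case: (pickP (fun _ : {ffun P -> 'I_K} => true)) => [u _|no]; last first.
    by rewrite big_pred0.
  have aT (F : {ffun P -> 'I_K} -> nat) :
      \sum_(X | agree (enum P) u X) F X = \sum_X F X.
    apply: eq_bigl => X; apply/forallP => x.
    by rewrite mem_enum.
  have := main (enum P) (enum_uniq _) u u u u.
  rewrite !aT; apply => i; [by rewrite maxnn|by rewrite minnn].
have split1 i D' F u : i \notin D' -> \sum_(X | agree (i :: D') u X) F X =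
    \sum_(t : 'I_K) \sum_(X | agree D' (upd u i t) X) F X :> nat.
  move=> iD; rewrite (partition_big (fun X : {ffun P -> 'I_K} => X i) predT) //=.
  apply: eq_bigr => t _; apply: eq_bigl => X.
  apply/andP/forallP => [[/forallP a /eqP Xi] x|a].
    rewrite ffunE; apply/implyP => xD; case: (x =P i) => [->|/eqP xi].
      by rewrite Xi.
    by move: (a x); rewrite inE negb_or xi xD.
  split; last by move: (a i); rewrite iD ffunE eqxx.
  apply/forallP => x; apply/implyP; rewrite inE negb_or => /andP[xi xD].
  by move: (a x); rewrite xD ffunE (negbTE xi).
elim: D => [_|i D IH /= /andP[iD /IH {}IH]] u v z w Hz Hw.
  have a0 F (y : {ffun P -> 'I_K}) : \sum_(X | agree [::] y X) F X = F y :> nat.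
    rewrite (big_pred1 y) // => X; apply/forallP/eqP => [a|-> x]; last by rewrite eqxx implybT.
    by apply/ffunP => x; apply/eqP; move: (a x).
  by rewrite !a0; apply: H.
rewrite !split1 //; apply: four_functions_chain => x y s t Hs Ht.
by apply: IH => j; rewrite !ffunE; case: eqP.
Qed.

(** * Counting bounded maps into the natural numbers *)

Definition nat_fun (P : finType) (K : nat) (X : {ffun P -> 'I_K}) : {ffun P -> nat} :=
  [ffun x => X x : nat].

(** A predicate on [nat]-valued maps does not involve [K], so counts under different bounds can be
    compared. *)
Definition bounded_count (P : finType) (K : nat) (Q : pred {ffun P -> nat}) : nat :=
  #|[set X : {ffun P -> 'I_K} | Q (nat_fun X)]|.

Lemma nat_fun_inj (P : finType) (K : nat) : injective (@nat_fun P K).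
Proof.
by move=> X Y /ffunP E; apply/ffunP => x; apply/val_inj; move: (E x); rewrite !ffunE.
Qed.

Lemma nat_fun_surj (P : finType) (K : nat) (Y : {ffun P -> nat}) :
  (forall x, Y x < K) -> exists X : {ffun P -> 'I_K}, nat_fun X = Y.
Proof.
move=> H; exists [ffun x => Ordinal (H x)].
by apply/ffunP => x; rewrite !ffunE.
Qed.

Lemma leq_bounded_count (P : finType) (K K' : nat) (Q Q' : pred {ffun P -> nat})
    (phi : {ffun P -> nat} -> {ffun P -> nat}) :
  (forall Y : {ffun P -> nat}, Q Y -> (forall x, Y x < K) ->
     Q' (phi Y) /\ (forall x, phi Y x < K')) ->
  {in Q &, injective phi} -> bounded_count K Q <= bounded_count K' Q'.
Proof.
move=> H inj; rewrite /bounded_count.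
have h (X : {ffun P -> 'I_K}) : Q (nat_fun X) ->
    exists Z : {ffun P -> 'I_K'}, nat_fun Z == phi (nat_fun X).
  move=> QX; have [|_ b] := H _ QX; first by move=> x; rewrite ffunE.
  by have [Z e] := nat_fun_surj b; exists Z; apply/eqP.
case: (set_0Vmem [set X : {ffun P -> 'I_K} | Q (nat_fun X)]) => [->|[X0 QX0]].
  by rewrite cards0.
have [Z0 _] : exists Z : {ffun P -> 'I_K'}, nat_fun Z == phi (nat_fun X0).
  by apply: h; rewrite inE in QX0.
(* [Z0] only makes [psi] total: under [Q] the choice succeeds. *)
pose psi (X : {ffun P -> 'I_K}) := odflt Z0 [pick Z | nat_fun Z == phi (nat_fun X)].
have psiE X : Q (nat_fun X) -> nat_fun (psi X) = phi (nat_fun X).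
  move=> /h[Z eZ]; rewrite /psi; case: pickP => [Z1 /eqP //|/(_ Z)].
  by rewrite eZ.
rewrite -(card_in_imset (f := psi)).
  apply/subset_leq_card/subsetP => y /imsetP[X]; rewrite inE => QX ->.
  have [|q _] := H _ QX; first by move=> x; rewrite ffunE.
  by rewrite inE psiE.
move=> X Y; rewrite !inE => QX QY e; apply: nat_fun_inj; apply: inj => //.
by rewrite -!psiE ?e.
Qed.

(** The four functions theorem for indicator functions. *)
Lemma four_bounded_counts (P : finType) (K : nat) (Q1 Q2 Q3 Q4 : pred {ffun P -> nat}) :
  (forall X Y : {ffun P -> nat}, (forall x, X x < K) -> (forall x, Y x < K) -> Q1 X -> Q2 Y ->
     Q3 [ffun x => maxn (X x) (Y x)] && Q4 [ffun x => minn (X x) (Y x)]) ->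
  bounded_count K Q1 * bounded_count K Q2 <= bounded_count K Q3 * bounded_count K Q4.
Proof.
move=> H; rewrite /bounded_count.
have E (Q : pred {ffun P -> nat}) : #|[set X : {ffun P -> 'I_K} | Q (nat_fun X)]| =
    \sum_(X : {ffun P -> 'I_K}) Q (nat_fun X).
  by rewrite -sum1dep_card big_mkcond; apply: eq_bigr => X _; case: (Q _).
rewrite !E; apply: four_functions => X Y Z W HZ HW.
case q1 : (Q1 _) => //; case q2 : (Q2 _) => //; rewrite mul1n.
have := H (nat_fun X) (nat_fun Y).
have -> : [ffun x => maxn (nat_fun X x) (nat_fun Y x)] = nat_fun Z.
  by apply/ffunP => x; rewrite !ffunE HZ.
have -> : [ffun x => minn (nat_fun X x) (nat_fun Y x)] = nat_fun W.
  by apply/ffunP => x; rewrite !ffunE HW.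
by case/(_ _ _ q1 q2)/andP => [x|x|-> ->] //; rewrite ffunE.
Qed.

(** * Discrete log-concavity and balancing *)

Definition down_step (J : finType) (U V : {ffun J -> nat}) : {ffun J -> nat} :=
  [ffun j => maxn (U j).-1 (V j)].

Definition up_step (J : finType) (U V : {ffun J -> nat}) : {ffun J -> nat} :=
  [ffun j => minn (U j) (V j).+1].

(* In each coordinate a step either permutes the two values or, when they
   differ by at least 2, moves them towards each other by one unit. *)
Definition step_logconcave (J : finType) (phi : {ffun J -> nat} -> nat) :=
  forall U V, phi U * phi V <= phi (down_step U V) * phi (up_step U V).

(** While two members differ by at least 2 in some coordinate, replace them by their two steps. The
    coordinate sums persist, the product does not decrease, and the sum of all squares drops, so the
    process stops. *)
Lemma balance (T J : finType) (phi : {ffun J -> nat} -> nat)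
    (U : T -> {ffun J -> nat}) :
  step_logconcave phi ->
  exists V : T -> {ffun J -> nat},
    [/\ forall j, \sum_t V t j = \sum_t U t j,
        \prod_t phi (U t) <= \prod_t phi (V t) &
        forall s t j, V s j <= (V t j).+1].
Proof.
move=> H.
have [n] := ubnP (\sum_t \sum_j (U t j) ^ 2).
elim: n U => // n IH U ltn.
case: (boolP [exists s, exists t, exists j, (U t j).+1 < U s j]); last first.
  rewrite negb_exists => /forallP h; exists U; split=> // s t j.
  move: (h s); rewrite negb_exists => /forallP/(_ t).
  by rewrite negb_exists => /forallP/(_ j); rewrite -leqNgt.
case/existsP => s /existsP[t] /existsP[j ltj].
have st : t != s by apply: contraTneq ltj => ->; lia.
pose V r := if r == s then down_step (U s) (U t)
            else if r == t then up_step (U s) (U t) else U r.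
have Vs : V s = down_step (U s) (U t) by rewrite /V eqxx.
have Vt : V t = up_step (U s) (U t) by rewrite /V (negbTE st) eqxx.
have Vr r : (r != s) && (r != t) -> V r = U r.
  by rewrite /V => /andP[/negbTE-> /negbTE->].
have sumV (F : {ffun J -> nat} -> nat) : \sum_r F (V r) =
    F (down_step (U s) (U t)) + (F (up_step (U s) (U t)) +
      \sum_(r | (r != s) && (r != t)) F (U r)).
  rewrite (bigD1 s) //= (bigD1 t) //= Vs Vt.
  by congr (_ + (_ + _)); apply: eq_bigr => r /Vr ->.
have sumU (F : {ffun J -> nat} -> nat) : \sum_r F (U r) =
    F (U s) + (F (U t) + \sum_(r | (r != s) && (r != t)) F (U r)).
  by rewrite (bigD1 s) //= (bigD1 t).
have prodUV : \prod_r phi (U r) <= \prod_r phi (V r).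
  rewrite (bigD1 s) //= (bigD1 t) //= [X in _ <= X](bigD1 s) //=.
  rewrite [X in _ <= _ * X](bigD1 t) //= Vs Vt.
  rewrite !mulnA leq_mul //.
  by apply/eq_leq/eq_bigr => r /Vr ->.
have [] := IH V.
  rewrite ltnS in ltn; apply: leq_trans ltn.
  rewrite (sumU (fun u => \sum_j (u j) ^ 2)) (sumV (fun u => \sum_j (u j) ^ 2)).
  rewrite !addnA ltn_add2r -!big_split /=.
  rewrite (bigD1 j) //= [X in _ < X](bigD1 j) //=.
  rewrite -addSn leq_add //; last apply: leq_sum => i _; rewrite !ffunE.
    by move: ltj; nia.
  by case: (leqP (U s i) (U t i)) => h; [rewrite (maxn_idPr _) ?(minn_idPl _)|]; nia.
move=> W [sW pW bW]; exists W; split => // [i|].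
  rewrite sW (sumU (fun u => u i)) (sumV (fun u => u i)) !ffunE !addnA.
  by congr (_ + _); lia.
exact: leq_trans prodUV pW.
Qed.

(** Take the member with the largest [phi] in the balanced family. It differs by at most one from
    the others and by zero from itself, hence by strictly less than one from the mean in each
    coordinate. *)
Lemma balance_mean (T J : finType) (phi : {ffun J -> nat} -> nat)
    (U : T -> {ffun J -> nat}) (t0 : T) :
  step_logconcave phi ->
  exists v : {ffun J -> nat},
    \prod_t phi (U t) <= phi v ^ #|T| /\
    forall j, #|T| * v j < \sum_t U t j + #|T| /\ \sum_t U t j < #|T| * (v j).+1.
Proof.
move=> /(balance U)[V [sV pV bV]].
pose t1 := [arg max_(t > t0) phi (V t)].
have maxP t : phi (V t) <= phi (V t1).
  by rewrite /t1; case: arg_maxnP => // i _; apply.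
exists (V t1); split.
  apply: leq_trans pV _; rewrite -prod_nat_const.
  by apply: leq_prod => t _; apply: maxP.
move=> j; rewrite -sV; split.
- rewrite -sum_nat_const -sum1_card -big_split /=.
  rewrite (bigD1 t1) //= [X in _ < X](bigD1 t1) //= -addSn.
  by rewrite leq_add //; [lia|apply: leq_sum => t _; move: (bV t1 t j); lia].
- rewrite -sum_nat_const (bigD1 t1) //= [X in _ < X](bigD1 t1) //= -addSn.
  by rewrite leq_add //; apply: leq_sum => t _; move: (bV t t1 j); lia.
Qed.

Lemma balance_pair (J : finType) (phi : {ffun J -> nat} -> nat) (U V : {ffun J -> nat}) :
  step_logconcave phi ->
  exists W : {ffun J -> nat} * {ffun J -> nat},
    phi U * phi V <= phi W.1 * phi W.2 /\
    forall j, [/\ W.1 j + W.2 j = U j + V j, W.1 j <= (W.2 j).+1 & W.2 j <= (W.1 j).+1].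
Proof.
move=> /(balance (fun b : bool => if b then U else V))[W [sW pW bW]].
exists (W true, W false); split; first by move: pW; rewrite !big_bool.
move=> j; split; [|exact: bW|exact: bW].
by move: (sW j); rewrite !big_bool.
Qed.

(** * Order-preserving maps with prescribed values *)

Section OrderMaps.
Variables (P : finType) (le : rel P).

Definition monotone (X : {ffun P -> nat}) : bool :=
  [forall x : P, forall y : P, le x y ==> (X x <= X y)].

Lemma monotoneP (X : {ffun P -> nat}) :
  reflect (forall x y : P, le x y -> X x <= X y) (monotone X).
Proof.
apply: (iffP forallP) => [h x y|h x].
  by move: (h x) => /forallP/(_ y)/implyP.
by apply/forallP => y; apply/implyP/h.
Qed.

(* The bound on the values is the coordinate [None] of [V]. *)
Definition fibre_count (I : finType) (iota : I -> P) (V : {ffun option I -> nat}) : nat :=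
  bounded_count (V None).+1
    [pred X | monotone X & [forall i, X (iota i) == V (Some i)]].

Let translate (I : finType) (iota : I -> P) (a : nat) (V : {ffun option I -> nat}) :=
  [pred X : {ffun P -> nat} | monotone X & [forall x, a <= X x <= V None + a] &&
     [forall i, X (iota i) == V (Some i) + a]].

Lemma fibre_count_translate (I : finType) (iota : I -> P) (a K : nat)
    (V : {ffun option I -> nat}) :
  V None + a < K -> bounded_count K (translate iota a V) = fibre_count iota V.
Proof.
move=> VK; apply/eqP; rewrite eqn_leq; apply/andP; split.
- apply: (leq_bounded_count (phi := fun X => [ffun x => X x - a])).
    move=> X /andP[/monotoneP mX /andP[/forallP bX /forallP sX]] _; split.
      apply/andP; split; first by apply/monotoneP => x y /mX; rewrite !ffunE; lia.
      by apply/forallP => i; rewrite ffunE (eqP (sX i)) addnK.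
    by move=> x; rewrite ffunE; move: (bX x); lia.
  move=> X Y /andP[_ /andP[/forallP bX _]] /andP[_ /andP[/forallP bY _]].
  move=> /ffunP e; apply/ffunP => x; move: (e x) (bX x) (bY x); rewrite !ffunE; lia.
- apply: (leq_bounded_count (phi := fun X => [ffun x => X x + a])).
    move=> X /andP[/monotoneP mX /forallP sX] bX; split.
      apply/and3P; split; first by apply/monotoneP => x y /mX; rewrite !ffunE; lia.
        by apply/forallP => x; rewrite ffunE; move: (bX x); lia.
      by apply/forallP => i; rewrite ffunE (eqP (sX i)).
    by move=> x; rewrite ffunE; move: (bX x); lia.
  by move=> X Y _ _ /ffunP e; apply/ffunP => x; move: (e x); rewrite !ffunE; lia.
Qed.

(** Count the maps [X] for [U] as they are and the maps [Y] for [V] translated by one unit. Then the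
    maximum of [X] and [Y] is a map for [down_step U V] translated by one unit, and their minimum a
    map for [up_step U V]. [K] exceeds all values involved. *)
Lemma fibre_count_step (I : finType) (iota : I -> P) :
  step_logconcave (fibre_count iota).
Proof.
suff H (U V : {ffun option I -> nat}) : fibre_count iota U * fibre_count iota V <=
    fibre_count iota (down_step U V) * fibre_count iota (up_step U V) by exact: H.
have dE (j : option I) : down_step U V j = maxn (U j).-1 (V j) by rewrite ffunE.
have uE (j : option I) : up_step U V j = minn (U j) (V j).+1 by rewrite ffunE.
pose K := (U None + V None).+2.
rewrite -(fibre_count_translate (a := 0) (K := K) iota (V := U)); last by rewrite /K; lia.
rewrite -(fibre_count_translate (a := 1) (K := K) iota (V := V)); last by rewrite /K; lia.
rewrite -(fibre_count_translate (a := 1) (K := K) iota (V := down_step U V)); last first.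
  by rewrite ?dE ?uE /K; lia.
rewrite -(fibre_count_translate (a := 0) (K := K) iota (V := up_step U V)); last first.
  by rewrite ?dE ?uE /K; lia.
apply: four_bounded_counts => X Y _ _.
move=> /and3P[/monotoneP mX /forallP bX /forallP sX].
move=> /and3P[/monotoneP mY /forallP bY /forallP sY].
apply/andP; split; apply/and3P; split.
- by apply/monotoneP => x y xy; move: (mX _ _ xy) (mY _ _ xy); rewrite ?dE ?uE !ffunE; lia.
- by apply/forallP => x; move: (bX x) (bY x); rewrite ?dE ?uE !ffunE; lia.
- by apply/forallP => i; rewrite ?dE ?uE !ffunE (eqP (sX i)) (eqP (sY i)); lia.
- by apply/monotoneP => x y xy; move: (mX _ _ xy) (mY _ _ xy); rewrite ?dE ?uE !ffunE; lia.
- by apply/forallP => x; move: (bX x) (bY x); rewrite ?dE ?uE !ffunE; lia.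
- by apply/forallP => i; rewrite ?dE ?uE !ffunE (eqP (sX i)) (eqP (sY i)); lia.
Qed.

End OrderMaps.

(* AM-GM for the quotients of [F (p x)] by the size of the fibre of [p x]. *)
Lemma card_leq_sum_fibres (T U : finType) (A : {set T}) (p : T -> U) (F : U -> nat) :
  \prod_(x in A) #|[set y in A | p y == p x]| <= \prod_(x in A) F (p x) ->
  #|A| <= \sum_u F u.
Proof.
case: (posnP #|A|) => [-> //|A0].
pose c u := #|[set y in A | p y == u]|.
have c0 x : x \in A -> 0 < c (p x).
  by move=> xA; apply/card_gt0P; exists x; rewrite inE xA eqxx.
rewrite -/(c _) => H.
pose E (x : T) : rat := ((F (p x))%:R / (c (p x))%:R)%R.
have E0 x : (0 <= E x)%R by apply: divr_ge0; apply: ler0n.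
have prodE : (1 <= \prod_(x in A) E x)%R.
  rewrite /E prodf_div -!natr_prod ler_pdivlMr ?mul1r ?ler_nat //.
  by rewrite ltr0n prodn_cond_gt0.
have [/(le_trans prodE) mu1 _] := leif_AGM (A := mem A) (fun x _ => E0 x).
have A0' : (0 < #|A|%:R :> rat)%R by rewrite ltr0n.
have sumE : (#|A|%:R <= \sum_(x in A) E x)%R.
  rewrite -[leLHS]mul1r -ler_pdivlMr //.
  rewrite -(ler_pXn2r A0) ?expr1n ?nnegrE ?ler01 //.
  by apply: divr_ge0; [apply: sumr_ge0 => x _; apply: E0|apply: ltW].
rewrite -(ler_nat rat) (le_trans sumE) // natr_sum.
rewrite (partition_big p predT) //=; apply: ler_sum => u _.
(* An empty fibre has no terms; on any other the quotient is constant and the terms add up to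
   [F u]. *)
case: (posnP (c u)) => cu.
  rewrite big_pred0 ?ler0n // => x.
  by apply/negbTE/negP => xA; move/card0_eq: cu => /(_ x); rewrite inE xA.
rewrite (eq_bigr (fun=> (F u)%:R / (c u)%:R)%R) => [|x /andP[_ /eqP <-] //].
rewrite sumr_const -[#|_|]/(#|[pred x | (x \in A) && (p x == u)]|).
rewrite (_ : #|_| = c u); last by apply: eq_card => x; rewrite !inE.
by rewrite -[leLHS]mulr_natr mulfVK // pnatr_eq0 -lt0n.
Qed.

(** * Comparison of the numbers of order-preserving maps for two bounds *)

Section Decay.
Variables (P : finType) (le : rel P) (I : finType) (iota : I -> P).

Definition order_maps (m : nat) : {set {ffun P -> 'I_m.+1}} :=
  [set X | monotone le (nat_fun X)].

Definition lift_point (m : nat) (u : {ffun I -> 'I_m.+1}) : {ffun option I -> nat} :=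
  [ffun o => if o is Some i then u i : nat else m].

Definition trace_map (m : nat) (X : {ffun P -> 'I_m.+1}) : {ffun I -> 'I_m.+1} :=
  [ffun i => X (iota i)].

Lemma fibre_count_lift (m : nat) (u : {ffun I -> 'I_m.+1}) :
  fibre_count le iota (lift_point u) = #|[set X in order_maps m | trace_map X == u]|.
Proof.
rewrite /fibre_count [lift_point u None]ffunE /bounded_count.
apply: eq_card => X; rewrite !inE; congr (_ && _).
apply/forallP/eqP => [h|<- i]; last by rewrite !ffunE.
by apply/ffunP => i; apply/val_inj; move: (h i); rewrite !ffunE => /eqP.
Qed.

Lemma sum_fibre_count_lift (m : nat) :
  \sum_(u : {ffun I -> 'I_m.+1}) fibre_count le iota (lift_point u) = #|order_maps m|.
Proof.
rewrite -sum1_card (partition_big (@trace_map m) predT) //=.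
by apply: eq_bigr => u _; rewrite fibre_count_lift -sum1dep_card;
  apply: eq_bigl => X; rewrite inE.
Qed.

Lemma lift_point_inj (m : nat) : injective (@lift_point m).
Proof.
move=> u w /ffunP e; apply/ffunP => i; apply/val_inj.
by move: (e (Some i)); rewrite !ffunE.
Qed.

Lemma fibre_count_gt0 (k : nat) (V : {ffun option I -> nat}) :
  V None = k -> 0 < fibre_count le iota V ->
  exists u : {ffun I -> 'I_k.+1}, V = lift_point u.
Proof.
move=> <-; case/card_gt0P => X; rewrite !inE => /andP[_ /forallP h].
exists (trace_map X); apply/ffunP => -[i|]; rewrite !ffunE //.
by move: (h i); rewrite ffunE => /eqP.
Qed.

(* Given one point [W u] of a nearly balanced pair, twice it determines
   [u + v] up to an error in {-1, 0, 1}, so the fibres have size at most 3^|I|. *)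
Lemma sum_fibre_count_balanced (m k : nat) (v : {ffun option I -> nat})
    (W : {ffun I -> 'I_m.+1} -> {ffun option I -> nat}) :
  (forall u, W u None = k) ->
  (forall u i, W u (Some i) * 2 <= u i + v (Some i) + 1 /\
               u i + v (Some i) <= W u (Some i) * 2 + 1) ->
  \sum_u fibre_count le iota (W u) <= 3 ^ #|I| * #|order_maps k|.
Proof.
move=> WN WS.
have fib (w : {ffun I -> 'I_k.+1}) : #|[set u | W u == lift_point w]| <= 3 ^ #|I|.
  have -> : 3 ^ #|I| = #|{ffun I -> 'I_3}| by rewrite card_ffun card_ord.
  (* Adding 1 brings the error [u + v - 2 w] from {-1, 0, 1} to {0, 1, 2}. *)
  pose psi (u : {ffun I -> 'I_m.+1}) : {ffun I -> 'I_3} :=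
    [ffun i => inord (u i + v (Some i) + 1 - w i * 2)].
  rewrite -(card_in_imset (f := psi)) ?max_card // => u u'.
  rewrite !inE => /eqP e /eqP e' /ffunP E; apply/ffunP => i; apply/val_inj => /=.
  move: (E i) (WS u i) (WS u' i); rewrite e e' !ffunE => /(congr1 val) /=.
  by move=> H [h1 h2] [h3 h4]; move: H; rewrite !inordK; lia.
rewrite -sum_fibre_count_lift big_distrr /=.
have -> : \sum_u fibre_count le iota (W u) =
    \sum_u \sum_(w : {ffun I -> 'I_k.+1} | W u == lift_point w)
      fibre_count le iota (lift_point w).
  (* A zero count contributes nothing; a positive one makes [W u] the lift of exactly one [w]. *)
  apply: eq_bigr => u _; case: (posnP (fibre_count le iota (W u))) => [E0|].
    by rewrite E0 big1 // => w /eqP <-.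
  move=> /(fibre_count_gt0 (WN u))[w ->].
  rewrite (big_pred1 w) // => w'; apply/eqP/eqP => [/lift_point_inj //|-> //].
rewrite (exchange_big_dep predT) //=.
apply: leq_sum => w _; rewrite sum_nat_const leq_mul2r; apply/orP; right.
by apply: leq_trans (fib w); rewrite cardsE.
Qed.
End Decay.

(** The conditions for lowering [X] by [s] on an up-set [B]: in turn, the result is monotone, no
    subtraction is truncated, and the values outside [B] respect the new bound [m - s]. *)
Definition separated_by (P : finType) (le : rel P) (B : {set P}) (m s : nat)
    (X : {ffun P -> nat}) : Prop :=
  [/\ forall x y, le x y -> x \notin B -> y \in B -> X x + s <= X y,
      forall x, x \in B -> s <= X x &
      forall x, x \notin B -> X x + s <= m].

Lemma fibre_count_shift (P : finType) (le : rel P) (I : finType) (iota : I -> P)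
    (B : {set P}) (m s : nat) (v : {ffun option I -> nat}) :
  (forall x y, le x y -> x \in B -> y \in B) -> v None = m ->
  (forall X : {ffun P -> nat}, monotone le X -> (forall i, X (iota i) = v (Some i)) ->
     separated_by le B m s X) ->
  fibre_count le iota v <= fibre_count le iota
    [ffun o => if o is Some i then v (Some i) - (iota i \in B) * s else m - s].
Proof.
move=> upB vN sep; rewrite /fibre_count [[ffun o => _] None]ffunE vN.
have sepQ X : monotone le X && [forall i, X (iota i) == v (Some i)] ->
    separated_by le B m s X.
  by case/andP => mX /forallP sX; apply: sep => // i; apply/eqP.
apply: (leq_bounded_count (phi := fun X => [ffun x => X x - (x \in B) * s])).
  move=> X QX bX; have [s1 s2 s3] := sepQ _ QX.
  case/andP: QX => /monotoneP mX /forallP sX; split.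
    apply/andP; split; last by apply/forallP => i; rewrite !ffunE (eqP (sX i)).
    apply/monotoneP => x y xy; rewrite !ffunE; have := mX _ _ xy.
    case xB: (x \in B); case yB: (y \in B) => /= h; [lia| |  | lia].
      by rewrite (upB _ _ xy xB) in yB.
    by have := s1 _ _ xy (negbT xB) yB; lia.
  move=> x; rewrite ffunE; have := bX x.
  by case xB: (x \in B); [have := s2 _ xB|have := s3 _ (negbT xB)]; lia.
move=> X Y /sepQ[_ hX _] /sepQ[_ hY _] /ffunP e; apply/ffunP => x; move: (e x).
by rewrite !ffunE; case xB: (x \in B); [have := hX _ xB; have := hY _ xB|]; lia.
Qed.

(** Balancing all traces gives one point [v] near the mean, with [phi v ^ #|Om|] at least the
    product of the fibre sizes. Lowering [B] turns [v] into [v'], with bound [m - 2 t]. Balancing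
    each trace against [v'] yields pairs with bound [m - t], to which AM-GM and the bound on the
    fibres of [W] apply. *)
Lemma order_maps_decay (P : finType) (le : rel P) (I : finType) (iota : I -> P)
    (B : {set P}) (m t : nat) :
  t.*2 <= m -> (forall x y, le x y -> x \in B -> y \in B) ->
  (forall v : I -> nat,
     (forall i, #|order_maps le m| * v i <
                  \sum_(X in order_maps le m) X (iota i) + #|order_maps le m| /\
                \sum_(X in order_maps le m) X (iota i) < #|order_maps le m| * (v i).+1) ->
     forall X : {ffun P -> nat}, monotone le X -> (forall i, X (iota i) = v i) ->
     separated_by le B m t.*2 X) ->
  #|order_maps le m| <= 3 ^ #|I| * #|order_maps le (m - t)|.
Proof.
move=> tm upB sep; set Om := order_maps le m.
case: (posnP #|Om|) => [-> //|Om0].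
pose phi := fibre_count le iota.
have phiC : step_logconcave phi by apply: fibre_count_step.
(* Indexing by maps and not by traces repeats each trace as often as its fibre is large. *)
pose U (k : 'I_#|Om|) := lift_point (trace_map iota (enum_val k)).
have [v [pv mv]] := balance_mean U (Ordinal Om0) phiC.
rewrite card_ord in pv mv.
have sumU (i : I) : \sum_k U k (Some i) = \sum_(X in Om) X (iota i).
  by rewrite [RHS]big_enum_val; apply: eq_bigr => k _; rewrite !ffunE.
have vN : v None = m.
  have := mv None; rewrite (eq_bigr (fun=> m)) => [|k _]; last by rewrite ffunE.
  by rewrite sum_nat_const card_ord; nia.
have vS i : #|Om| * v (Some i) < \sum_(X in Om) X (iota i) + #|Om| /\
            \sum_(X in Om) X (iota i) < #|Om| * (v (Some i)).+1.
  by rewrite -sumU.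
have := fibre_count_shift upB vN (sep (fun i => v (Some i)) vS).
set v' := [ffun o => _] => shift.
have [W HW] := fin_all_exists (fun u : {ffun I -> 'I_m.+1} =>
  balance_pair (lift_point u) v' phiC).
(* The sum [m + (m - 2 t)] is even, so two parts that differ by at most one are equal. *)
have WN u : (W u).1 None = m - t /\ (W u).2 None = m - t.
  by have [_ /(_ None)[]] := HW u; rewrite !ffunE; lia.
have WS u (i : I) : [/\ (W u).1 (Some i) + (W u).2 (Some i) = u i + v' (Some i),
    (W u).1 (Some i) <= ((W u).2 (Some i)).+1 & (W u).2 (Some i) <= ((W u).1 (Some i)).+1].
  by have [_ /(_ (Some i))[]] := HW u; rewrite [lift_point u _]ffunE.
pose c X := #|[set Y in Om | trace_map iota Y == trace_map iota X]|.
have cE X : c X = phi (lift_point (trace_map iota X)).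
  by rewrite /phi fibre_count_lift.
have prodc : \prod_(X in Om) c X <= phi v ^ #|Om|.
  rewrite big_enum_val; apply: leq_trans pv; apply/eq_leq/eq_bigr => k _.
  exact: cE.
have prodFG : (\prod_(X in Om) c X) * (\prod_(X in Om) c X) <=
    (\prod_(X in Om) phi (W (trace_map iota X)).1) *
    (\prod_(X in Om) phi (W (trace_map iota X)).2).
  apply: (@leq_trans ((\prod_(X in Om) c X) * phi v' ^ #|Om|)).
    by rewrite leq_mul2l (leq_trans prodc) ?orbT // leq_exp2r.
  rewrite -prod_nat_const -!big_split /=; apply: leq_prod => X _.
  by have [h _] := HW (trace_map iota X); rewrite cE.
have bound (F : {ffun I -> 'I_m.+1} -> {ffun option I -> nat}) :
    \prod_(X in Om) c X <= \prod_(X in Om) phi (F (trace_map iota X)) ->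
    (forall u, F u None = m - t) ->
    (forall u i, F u (Some i) * 2 <= u i + v' (Some i) + 1 /\
               u i + v' (Some i) <= F u (Some i) * 2 + 1) ->
    #|Om| <= 3 ^ #|I| * #|order_maps le (m - t)|.
  move=> H FN FS; apply: leq_trans (sum_fibre_count_balanced le iota FN FS).
  exact: card_leq_sum_fibres H.
have near (a b e : nat) : a + b = e -> a <= b.+1 -> b <= a.+1 ->
    (a * 2 <= e + 1 /\ e <= a * 2 + 1) /\ (b * 2 <= e + 1 /\ e <= b * 2 + 1) by lia.
(* By [prodFG], at least one of the two products over [W] reaches the product of the [c X]. *)
case: (leqP (\prod_(X in Om) c X) (\prod_(X in Om) phi (W (trace_map iota X)).1)) => h1.
  apply: (bound (fun u => (W u).1)) => // u; first by case: (WN u).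
  by move=> i; have [e1 e2 e3] := WS u i; have [] := near _ _ _ e1 e2 e3.
apply: (bound (fun u => (W u).2)) => [|u|u i]; last first.
- by have [e1 e2 e3] := WS u i; have [] := near _ _ _ e1 e2 e3.
- by case: (WN u).
rewrite leqNgt; apply/negP => h2; have := ltn_mul h1 h2.
by rewrite ltnNge prodFG.
Qed.

(** * Means of the entries of increasing sequences *)

Section IncreasingSequences.
Variables n M : nat.
Implicit Types z : {ffun 'I_n -> 'I_M}.

Definition increasing_maps : {set {ffun 'I_n -> 'I_M}} :=
  [set z : {ffun 'I_n -> 'I_M} | [forall i : 'I_n, forall j : 'I_n, (i < j) ==> (z i < z j)]].

Lemma increasing_mapsP z :
  reflect (forall i j : 'I_n, i < j -> z i < z j) (z \in increasing_maps).
Proof.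
rewrite inE; apply: (iffP forallP) => [h i j|h i].
  by move: (h i) => /forallP/(_ j)/implyP.
by apply/forallP => j; apply/implyP/h.
Qed.

Lemma card_increasing_maps : #|increasing_maps| = 'C(M, n).
Proof.
rewrite -card_ltn_sorted_tuples.
pose F (t : n.-tuple 'I_M) : {ffun 'I_n -> 'I_M} := [ffun i => tnth t i].
have F_inj : injective F.
  by move=> t t' /ffunP e; apply: eq_from_tnth => i; move: (e i); rewrite !ffunE.
rewrite -(card_imset _ F_inj); apply: eq_card => z.
have sortE (t : n.-tuple 'I_M) : sorted ltn [seq val i | i <- t] = (F t \in increasing_maps).
  have nthE (i : 'I_n) : nth 0 [seq val i | i <- t] i = F t i :> nat.
    by have x0 := tnth t i; rewrite ffunE (nth_map x0) ?size_tuple // (tnth_nth x0).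
  apply/idP/increasing_mapsP => [s i j ij|h].
    by rewrite -!nthE; apply: (sorted_ltn_nth ltn_trans) => //; rewrite inE size_map size_tuple.
  apply/(sortedP 0) => i; rewrite size_map size_tuple => iN.
  by have := h (Ordinal (ltnW iN)) (Ordinal iN) (ltnSn i); rewrite -!nthE.
apply/idP/imsetP => [zI|[t]]; last by rewrite inE sortE => ? ->.
have Fz : F [tuple z i | i < n] = z by apply/ffunP => i; rewrite ffunE tnth_mktuple.
by exists [tuple z i | i < n]; rewrite ?inE ?sortE Fz.
Qed.

(* The labels [z i + 1], preceded by 0 and followed by [M + 1]. *)
Definition extend z (k : nat) : nat :=
  if k is k'.+1 then if insub k' is Some i then (z i).+1 else M.+1 else 0.

Arguments extend : simpl never.

Lemma extend_ord z (i : 'I_n) : extend z i.+1 = (z i).+1.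
Proof. by rewrite /extend valK. Qed.

Lemma extend_last z : extend z n.+1 = M.+1.
Proof. by rewrite /extend insubF // ltnn. Qed.

Lemma extend_le z k : extend z k <= M.+1.
Proof.
by case: k => // k; rewrite /extend; case: insubP => // i _ _; rewrite ltnS ltnW.
Qed.

Lemma extend_ltS z k : z \in increasing_maps -> k <= n -> extend z k < extend z k.+1.
Proof.
move=> /increasing_mapsP zI; rewrite leq_eqVlt => /predU1P[kn|kn].
  rewrite {2}kn extend_last; case: k kn => // k kn.
  have kn' : k < n by rewrite -kn.
  by rewrite (extend_ord z (Ordinal kn')) ltnS.
rewrite (extend_ord z (Ordinal kn)); case: k kn => // k kn.
by rewrite (extend_ord z (Ordinal (ltnW kn))) ltnS; apply: zI.
Qed.

Lemma increasing_of_extend z :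
  (forall k, k <= n -> extend z k < extend z k.+1) -> z \in increasing_maps.
Proof.
move=> h; apply/increasing_mapsP => i j ij; rewrite -ltnS -!extend_ord.
have : j < n.+1 by rewrite ltnW // ltnS.
elim: (nat_of_ord j) ij => // k IH; rewrite ltnS leq_eqVlt => /predU1P[->|ik] kn.
  exact: h.
by apply: ltn_trans (IH ik _) (h _ _); lia.
Qed.

(** The label at [k] is mirrored between its two neighbours. Labels are entries plus one, for the
    old entry and for the new one, whence [.+2]. On increasing maps the default of [insubd] does not
    occur. *)
Definition reflect_at (k : 'I_n) z : {ffun 'I_n -> 'I_M} :=
  [ffun j => if j == k then insubd (z k) (extend z k + extend z k.+2 - (z k).+2) else z j].

Lemma extend_reflect (k : 'I_n) z j : z \in increasing_maps ->
  extend (reflect_at k z) j =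
    if j == k.+1 then extend z k + extend z k.+2 - extend z k.+1 else extend z j.
Proof.
move=> zI; case: j => // j; rewrite eqSS.
case: (ltnP j n) => jn; last first.
  by rewrite /extend insubF ?ltnNge ?jn // gtn_eqF // (leq_trans (ltn_ord k)).
rewrite (extend_ord _ (Ordinal jn)) ffunE -val_eqE /=.
case: (j =P k) => [jk|_]; last by rewrite (extend_ord z (Ordinal jn)).
have h1 := extend_ltS zI (ltnW (ltn_ord k)).
have h2 := extend_ltS zI (ltn_ord k).
have h3 := extend_le z k.+2.
rewrite insubdK; first by rewrite extend_ord in h1 h2 *; lia.
by rewrite -topredE /=; rewrite extend_ord in h1 h2; lia.
Qed.

Lemma reflect_increasing (k : 'I_n) z :
  z \in increasing_maps -> reflect_at k z \in increasing_maps.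
Proof.
move=> zI; apply: increasing_of_extend => j jn; rewrite !extend_reflect // eqSS.
have h1 := extend_ltS zI (ltnW (ltn_ord k)).
have h2 := extend_ltS zI (ltn_ord k).
have h := extend_ltS zI jn.
case: (j =P k.+1) => [e|_]; case: (j =P k :> nat) => [e'|_] //; first by lia.
  by rewrite e; lia.
by rewrite e'; lia.
Qed.

Lemma reflectK (k : 'I_n) z : z \in increasing_maps -> reflect_at k (reflect_at k z) = z.
Proof.
move=> zI; apply/ffunP => j; apply/val_inj/succn_inj.
rewrite -!extend_ord !extend_reflect ?reflect_increasing //.
rewrite eqxx (ltn_eqF (ltnSn k)) (gtn_eqF (ltnSn k.+1)).
have h1 := extend_ltS zI (ltnW (ltn_ord k)).
have h2 := extend_ltS zI (ltn_ord k).
case: (j.+1 =P k.+1) => [[jk]|_] //.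
by rewrite jk; lia.
Qed.

(* Reflection exchanges two consecutive differences of the extended sequence,
   so all of these have the same sum over [increasing_maps]. *)
Lemma sum_increasing_maps (i : 'I_n) :
  n.+1 * \sum_(z in increasing_maps) (z i).+1 = i.+1 * M.+1 * 'C(M, n).
Proof.
pose S k := \sum_(z in increasing_maps) extend z k.
have rec k : k < n -> S k.+1 + S k.+1 = S k + S k.+2.
  move=> kn; pose K := Ordinal kn.
  have E : S k.+1 = \sum_(z in increasing_maps) extend (reflect_at K z) k.+1.
    rewrite /S (reindex_onto (reflect_at K) (reflect_at K)) /= => [|z]; last exact: reflectK.
    apply: eq_bigl => z; apply/andP/idP => [[h /eqP <-]|h]; first exact: reflect_increasing.
    by rewrite reflect_increasing // reflectK.
  rewrite {2}E /S -!big_split /=; apply: eq_bigr => z zI.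
  have h1 := extend_ltS zI (ltnW kn); have h2 := extend_ltS zI kn.
  by rewrite extend_reflect //= eqxx; lia.
have S0 : S 0 = 0 by rewrite /S big1.
have lin k : k <= n -> S k = k * S 1 /\ S k.+1 = k.+1 * S 1.
  elim: k => [|k IH] kn; first by rewrite S0 mul1n.
  by have [h1 h2] := IH (ltnW kn); have := rec _ kn; split=> //; nia.
have Sn : S n.+1 = M.+1 * 'C(M, n).
  rewrite /S (eq_bigr (fun=> M.+1)) => [|z _]; last exact: extend_last.
  by rewrite sum_nat_const card_increasing_maps mulnC.
have -> : \sum_(z in increasing_maps) (z i).+1 = S i.+1.
  by apply: eq_bigr => z _; rewrite extend_ord.
have [_ e1] := lin _ (leqnn n); have [e2 _] := lin _ (ltn_ord i).
by rewrite -mulnA -Sn e1 e2; lia.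
Qed.

End IncreasingSequences.

(** * Order-preserving maps and linear extensions *)

Section InjectiveMaps.
Variables (P : finType) (le : rel P).

Definition injective_maps (M : nat) : {set {ffun P -> 'I_M}} :=
  [set Y : {ffun P -> 'I_M} | injectiveb Y & monotone le (nat_fun Y)].

Definition rank (Y : P -> nat) (x : P) : nat := #|[set y | Y y < Y x]|.

Lemma rank_lt (Y : P -> nat) (x y : P) : (rank Y x < rank Y y) = (Y x < Y y).
Proof.
case: (ltnP (Y x) (Y y)) => h.
  apply/proper_card/properP; split; last by exists x; rewrite !inE ?ltnn.
  by apply/subsetP => z; rewrite !inE => /ltn_trans; apply.
apply/negbTE; rewrite -leqNgt; apply/subset_leq_card/subsetP => z.
by rewrite !inE => /leq_trans; apply.
Qed.

Lemma rank_le (Y : P -> nat) (x y : P) : (rank Y x <= rank Y y) = (Y x <= Y y).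
Proof. by rewrite leqNgt rank_lt -leqNgt. Qed.

Lemma rank_bound (Y : P -> nat) (x : P) : rank Y x < #|P|.
Proof.
rewrite -cardsT; apply/proper_card/properP; split; first exact: subsetT.
by exists x; rewrite ?inE ?ltnn.
Qed.

Lemma eq_rank (Y Z : P -> nat) :
  (forall x y, (Y x < Y y) = (Z x < Z y)) -> rank Y =1 rank Z.
Proof. by move=> h x; apply: eq_card => y; rewrite !inE h. Qed.

Lemma rank_permutation (f : {ffun P -> 'I_#|P|}) : injective f ->
  forall x, rank (fun y => f y) x = f x.
Proof.
move=> f_inj x; rewrite /rank -(card_imset _ f_inj).
have [g gK fK] : bijective f by apply: inj_card_bij; rewrite ?card_ord.
have -> : f @: [set y | f y < f x] = [set i : 'I_#|P| | i < f x].
  apply/setP => i; rewrite inE; apply/imsetP/idP => [[y]|ix].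
    by rewrite inE => ? ->.
  by exists (g i); rewrite ?inE ?fK.
rewrite -sum1dep_card -(big_ord_widen _ (fun=> 1)) ?(ltnW (ltn_ord _)) //.
by rewrite sum1_card card_ord.
Qed.

Definition rank_fun (M : nat) (Y : {ffun P -> 'I_M}) : {ffun P -> 'I_#|P|} :=
  [ffun x => Ordinal (rank_bound (fun y => Y y) x)].

Lemma rank_fun_injective (M : nat) (Y : {ffun P -> 'I_M}) :
  Y \in injective_maps M -> rank_fun Y \in injective_maps #|P|.
Proof.
rewrite !inE => /andP[/injectiveP Y_inj /monotoneP mY]; apply/andP; split.
  apply/injectiveP => x y; rewrite !ffunE => /(congr1 val) /= e.
  by apply/Y_inj/val_inj/eqP; rewrite eqn_leq -!(rank_le (fun y => Y y)) e leqnn.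
apply/monotoneP => x y /mY; rewrite !ffunE /= => h.
by rewrite (rank_le (fun y => Y y)).
Qed.

(** An injective order-preserving map factors uniquely as a linear extension, given by its ranks,
    followed by an increasing map. *)
Lemma sum_injective_maps (M : nat) (G : {ffun P -> 'I_M} -> nat) :
  \sum_(Y in injective_maps M) G Y =
  \sum_(f in injective_maps #|P|) \sum_(z in increasing_maps #|P| M) G [ffun x => z (f x)].
Proof.
rewrite (partition_big (@rank_fun M) (mem (injective_maps #|P|))) /=; last first.
  exact: rank_fun_injective.
apply: eq_bigr => f; rewrite inE => /andP[/injectiveP f_inj /monotoneP mf].
have [g gK fK] : bijective f by apply: inj_card_bij; rewrite ?card_ord.
rewrite (reindex_onto (fun z : {ffun 'I_#|P| -> 'I_M} => [ffun x => z (f x)])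
                      (fun Y : {ffun P -> 'I_M} => [ffun i => Y (g i)])) /=; last first.
  by move=> Y _; apply/ffunP => x; rewrite !ffunE gK.
apply: eq_bigl => z; apply/idP/idP.
  case/andP => /andP[_ /eqP rf] _; apply/increasing_mapsP => i j.
  rewrite -{1}(fK i) -{1}(fK j) -rf !ffunE /=.
  by rewrite (rank_lt (fun y => [ffun x => z (f x)] y)) !ffunE !fK.
move=> /increasing_mapsP zI.
have zmono (i j : 'I_#|P|) : (z i < z j) = (i < j).
  apply/idP/idP; last exact: zI.
  apply: contraTT; rewrite -!leqNgt leq_eqVlt => /predU1P[/val_inj -> //|/zI/ltnW //].
have z_inj : injective z.
  by move=> i j e; apply/val_inj; case: (ltngtP i j) => // /zI; rewrite e ltnn.
apply/andP; split; last by apply/eqP/ffunP => i; rewrite !ffunE fK.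
apply/andP; split.
  rewrite inE; apply/andP; split.
    apply/injectiveP => x y; by rewrite !ffunE => /z_inj/f_inj.
  apply/monotoneP => x y /mf; rewrite !ffunE => h.
  by rewrite leqNgt zmono -leqNgt.
apply/eqP/ffunP => x; apply/val_inj; rewrite ffunE /= -(rank_permutation f_inj x).
by apply: eq_rank => a b; rewrite !ffunE zmono.
Qed.

Lemma card_injective_maps (M : nat) :
  #|injective_maps M| = #|injective_maps #|P| | * 'C(M, #|P|).
Proof.
rewrite -sum1_card sum_injective_maps.
under eq_bigr do rewrite sum1_card card_increasing_maps.
by rewrite sum_nat_const.
Qed.

(** Thus the mean label of [x] over injective maps is its mean over linear extensions, scaled by
    [(M + 1) / (n + 1)]. *)
Lemma sum_label_injective_maps (M : nat) (x : P) :
  #|P|.+1 * \sum_(Y in injective_maps M) (Y x).+1 =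
  (\sum_(f in injective_maps #|P|) (f x).+1) * M.+1 * 'C(M, #|P|).
Proof.
rewrite sum_injective_maps big_distrr -mulnA big_distrl /=.
apply: eq_bigr => f _; rewrite mulnA -sum_increasing_maps; congr (_ * _).
by apply: eq_bigr => z _; rewrite ffunE.
Qed.

Lemma injective_maps_subset (m : nat) : injective_maps m.+1 \subset order_maps le m.
Proof. by apply/subsetP => Y; rewrite !inE => /andP[]. Qed.

(* Ties in an order map are broken by a linear extension; adding the ranks
   makes the map injective, and the ranks can be read off from the result. *)
Lemma order_maps_embedding (m : nat) (e : {ffun P -> nat}) :
  injective e -> monotone le e ->
  exists psi : {ffun P -> 'I_m.+1} -> {ffun P -> 'I_(m + #|P|)},
    [/\ {in order_maps le m, forall X, psi X \in injective_maps (m + #|P|)},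
        {in order_maps le m &, injective psi} &
        forall (X : {ffun P -> 'I_m.+1}) x, X x <= psi X x].
Proof.
move=> e_inj /monotoneP me; pose E := (\sum_x e x).+1.
have eE x : e x < E by rewrite ltnS (bigD1 x) //= leq_addr.
(* As [e x < E], this compares [X] first and [e] on ties. *)
pose Y0 (X : {ffun P -> 'I_m.+1}) x := X x * E + e x.
have Y0_le X x y : Y0 X x <= Y0 X y -> X x <= X y.
  by move: (eE x) (eE y); rewrite /Y0; nia.
have Y0_inj X x y : Y0 X x = Y0 X y -> x = y.
  move=> h; have h1 := Y0_le X x y (eq_leq h); have h2 := Y0_le X y x (eq_leq (esym h)).
  apply: e_inj; move: h; rewrite /Y0 (_ : X x = X y :> nat); first exact: addnI.
  by apply/eqP; rewrite eqn_leq h1.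
have bound (X : {ffun P -> 'I_m.+1}) x : X x + rank (Y0 X) x < m + #|P|.
  by move: (rank_bound (Y0 X) x) (ltn_ord (X x)); lia.
pose psi X : {ffun P -> 'I_(m + #|P|)} := [ffun x => Ordinal (bound X x)].
have psi_lt X x y : (psi X x < psi X y) = (Y0 X x < Y0 X y).
  rewrite !ffunE /=; case: (ltngtP (Y0 X x) (Y0 X y)) => h.
  - by have := Y0_le _ _ _ (ltnW h); move: h; rewrite -rank_lt; lia.
  - by have := Y0_le _ _ _ (ltnW h); move: h; rewrite -rank_lt; lia.
  - by rewrite (Y0_inj _ _ _ h) ltnn.
exists psi; split.
- move=> X; rewrite !inE => /monotoneP mX; apply/andP; split.
    apply/injectiveP => x y h; apply: (Y0_inj X).
    have h1 := psi_lt X x y; have h2 := psi_lt X y x; rewrite h ltnn in h1 h2.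
    by case: (ltngtP (Y0 X x) (Y0 X y)) h1 h2.
  apply/monotoneP => x y xy; rewrite ![nat_fun _ _]ffunE leqNgt (psi_lt X y x) -leqNgt.
  by move: (mX _ _ xy) (me _ _ xy); rewrite !ffunE /Y0; nia.
- move=> X X' _ _ h; apply/ffunP => x; apply/val_inj.
  have r : rank (Y0 X) x = rank (Y0 X') x.
    by apply: eq_rank => a b; rewrite -(psi_lt X a b) -(psi_lt X' a b) h.
  by move/ffunP/(_ x): h; rewrite !ffunE => /(congr1 val) /=; rewrite r => /addIn.
- by move=> X x; rewrite ffunE leq_addr.
Qed.

(** The order maps contain the injective ones with [m + 1] values and embed into those with [m + n]
    values. The embedding lowers no label, so the label sums are enclosed as well. *)
Lemma order_maps_estimates (m : nat) (e : {ffun P -> nat}) :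
  injective e -> monotone le e ->
  let l := #|injective_maps #|P| | in
  let q x := \sum_(f in injective_maps #|P|) (f x).+1 in
  [/\ l * 'C(m.+1, #|P|) <= #|order_maps le m|,
      #|order_maps le m| <= l * 'C(m + #|P|, #|P|) &
      forall x, q x * m.+2 * 'C(m.+1, #|P|) <=
                  #|P|.+1 * \sum_(X in order_maps le m) (X x).+1 /\
                #|P|.+1 * \sum_(X in order_maps le m) (X x).+1 <=
                  q x * (m + #|P|).+1 * 'C(m + #|P|, #|P|)].
Proof.
move=> e_inj me l q; have [psi [psiT psi_inj psi_le]] := order_maps_embedding m e_inj me.
rewrite /l -!card_injective_maps; split.
- exact/subset_leq_card/injective_maps_subset.
- rewrite -(card_in_imset psi_inj); apply/subset_leq_card/subsetP => Y /imsetP[X XO ->].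
  exact: psiT.
move=> x; rewrite /q -!sum_label_injective_maps !leq_mul2l /=; split.
  rewrite [X in _ <= X](big_setID (injective_maps m.+1)) /=.
  by rewrite (setIidPr (injective_maps_subset m)) leq_addr.
apply: (@leq_trans (\sum_(X in order_maps le m) (psi X x).+1)).
  by apply: leq_sum => X _; rewrite ltnS.
rewrite -(big_imset (fun Y : {ffun P -> 'I_(m + #|P|)} => (Y x).+1) psi_inj) /=.
rewrite [X in _ <= X](big_setID (psi @: order_maps le m)) /=.
rewrite (setIidPr _) ?leq_addr //.
by apply/subsetP => Y /imsetP[X XO ->]; apply: psiT.
Qed.

End InjectiveMaps.

(** * Numerical estimates *)

(** The induction step rests on [(M + j + 1) * (w - j - 1) <= (M + j + 1 - n) * (w - j)], a
    consequence of [n * w <= M + 1]. *)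
Lemma bin_shift_upper (n w M j : nat) : n * w <= M.+1 -> j <= w ->
  'C(M + j, n) * (w - j) <= 'C(M, n) * w.
Proof.
move=> wM; elim: j => [|j IH] jw; first by rewrite addn0 subn0.
have D0 : 0 < M + j.+1 by lia.
rewrite -(leq_pmul2l D0); apply: (@leq_trans ('C(M + j.+1, n) * ((M + j.+1 - n) * (w - j)))).
  rewrite mulnCA leq_mul2l; apply/orP; right.
  case: (leqP n (M + j.+1)) => nD; last by nia.
  by have := mulnBl (M + j.+1) n (w - j); nia.
have := IH (ltnW jw); rewrite -(leq_pmul2l D0) mulnA.
have := mul_bin_down (M + j.+1) n; rewrite {2}addnS /= => ->.
by rewrite -mulnA mulnCA.
Qed.

(** By Pascal's rule each unit of [u] adds at least ['C(M, n - 1)], and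
    [M * 'C(M, n - 1) >= n * 'C(M, n)]. *)
Lemma bin_shift_lower (n M u : nat) : 0 < n ->
  'C(M, n) * (M + u * n) <= 'C(M + u, n) * M.
Proof.
case: n => // n _; elim: u => [|u IH]; first by rewrite mul0n !addn0.
rewrite addnS binS mulnDl mulSn [n.+1 + _]addnC addnA mulnDr leq_add //.
apply: (@leq_trans ('C(M, n) * M)).
  have := mul_bin_left M n; have : M - n <= M by lia.
  by nia.
by rewrite leq_mul2r leq_bin2l ?orbT // leq_addr.
Qed.

Local Open Scope ring_scope.

(** The chain [v <= S / O <= q D c2 / (N1 l c1) <= a D / (N1 t)], cleared of denominators. It will
    be used with [O] and [S] the number and label sum of the order maps, [l] and [q] those of the
    linear extensions, and [c1], [c2] the two binomial coefficients. *)
Lemma mean_value_upper (R : realFieldType) (N1 D l c1 c2 O S q v a t : R) :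
  0 < l -> 0 < c2 -> 0 <= v -> 0 <= D -> 0 <= N1 -> t * c2 <= c1 -> l * c1 <= O ->
  O * v <= S -> N1 * S <= q * D * c2 -> q <= a * l -> N1 * t * v <= a * D.
Proof.
move=> l0 c0 v0 D0 N0 h1 h2 h3 h4 h5; have lc : 0 < l * c2 by apply: mulr_gt0.
rewrite -(ler_pM2l lc).
have e1 : t * c2 * (N1 * l * v) <= c1 * (N1 * l * v).
  by rewrite ler_wpM2r // !mulr_ge0 // ltW.
have e2 : l * c1 * (N1 * v) <= O * (N1 * v) by rewrite ler_wpM2r // mulr_ge0.
have e3 : N1 * (O * v) <= N1 * S by rewrite ler_wpM2l.
have e4 : q * (D * c2) <= a * l * (D * c2).
  by rewrite ler_wpM2r // mulr_ge0 // ltW.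
by lra.
Qed.

(** In [v + 2], one unit is the distance of [v] from the mean and one the passage from values to
    labels. *)
Lemma mean_value_lower (R : realFieldType) (N1 D l c1 c2 O S q v b t : R) :
  0 < l -> 0 < c2 -> 0 <= c1 -> 0 <= v -> 0 <= D -> 0 <= N1 -> 0 <= b ->
  t * c2 <= c1 -> O <= l * c2 -> S <= O * (v + 2) -> q * D * c1 <= N1 * S ->
  b * l <= q -> b * D * t <= N1 * (v + 2).
Proof.
move=> l0 c0 c10 v0 D0 N0 b0 h1 h2 h3 h4 h5; have lc : 0 < l * c2 by apply: mulr_gt0.
rewrite -(ler_pM2l lc).
have e1 : t * c2 * (b * l * D) <= c1 * (b * l * D).
  by rewrite ler_wpM2r // !mulr_ge0 // ltW.
have e2 : b * l * (D * c1) <= q * (D * c1) by rewrite ler_wpM2r // mulr_ge0.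
have e3 : N1 * S <= N1 * (O * (v + 2)) by rewrite ler_wpM2l.
have e4 : O * (N1 * (v + 2)) <= l * c2 * (N1 * (v + 2)).
  by rewrite ler_wpM2r // mulr_ge0 // addr_ge0.
by lra.
Qed.

(** In the scale [mu = (m + 2) / (n + 1)], one gets [v <= (mu + 1) (a + 1/5)],
    [w >= mu (b - 1/10) - 2] and [s <= (b - a - 1) mu]. The unit kept back in [s] pays for all
    errors because [mu >= 5 (n + 1)]. *)
Lemma separation_estimate (R : realFieldType) (n m a b s v w : R) :
  1 <= n -> m + 2 = n + n * n * (10 * (n + 1)) -> 0 <= a -> a + 1 <= b -> b <= n + 1 ->
  s * (n + 1) <= (b - a - 1) * (m + 2) ->
  (n + 1) * (1 - (10 * (n + 1))^-1) * v <= a * (m + n + 1) ->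
  b * (m + 2) * (1 - (10 * (n + 1))^-1) <= (n + 1) * (w + 2) ->
  v + s <= w.
Proof.
move=> n1 mE a0 ab bn hs hv hw.
pose nu := n + 1; pose mu := (m + 2) / nu; pose eps := (10 * nu)^-1.
have nu0 : 0 < nu by rewrite /nu; lra.
have muE : m + 2 = mu * nu by rewrite /mu divfK // gt_eqF.
have epsE : eps * nu = 10^-1 by rewrite /eps; field; rewrite gt_eqF.
have eps0 : 0 <= eps by rewrite invr_ge0; lra.
have eps1 : eps <= 20^-1.
  by rewrite -(ler_pM2r nu0) epsE /nu; lra.
have mu5 : 5 * nu <= mu.
  rewrite -(ler_pM2r nu0) -muE mE /nu.
  have := mulr_ge0 (_ : 0 <= n - 1) (_ : 0 <= n); nra.
have nu2 : 2 <= nu by rewrite /nu; lra.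
have sm : s <= (b - a - 1) * mu by rewrite -(ler_pM2r nu0) -mulrA -muE.
have hv1 : (1 - eps) * v <= a * (mu + 1).
  rewrite -(ler_pM2l nu0) mulrA; apply: le_trans hv _.
  have -> : nu * (a * (mu + 1)) = a * (mu * nu + nu) by ring.
  by rewrite -muE ler_wpM2l // /nu; lra.
have hw1 : b * mu * (1 - eps) <= w + 2.
  rewrite -(ler_pM2l nu0); apply: le_trans hw.
  by rewrite muE /eps /nu; lra.
have aeps : a * eps <= 10^-1 by rewrite -epsE [eps * _]mulrC ler_wpM2r //; rewrite /nu; lra.
have beps : b * eps <= 10^-1 by rewrite -epsE [eps * _]mulrC ler_wpM2r.
have mu0 : 0 <= mu by lra.
have hv2 : v <= (mu + 1) * (a + 5^-1).
  have av : a * (mu + 1) <= (1 - eps) * ((mu + 1) * (a + 5^-1)).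
    have -> : (1 - eps) * ((mu + 1) * (a + 5^-1)) =
       (mu + 1) * (a + (5^-1 - a * eps - eps * 5^-1)) by ring.
    by rewrite mulrC ler_wpM2l; lra.
  have p : 0 < 1 - eps by lra.
  by rewrite -(ler_pM2l p) (le_trans hv1).
have hb : mu * (b * eps) <= mu * 10^-1 by rewrite ler_wpM2l.
have an : a <= nu by rewrite /nu; lra.
lra.
Qed.

Lemma order_maps_gt0 (P : finType) (le : rel P) (m : nat) : (0 < #|order_maps le m|)%N.
Proof.
apply/card_gt0P; exists [ffun=> ord0]; rewrite inE.
by apply/monotoneP => x y _; rewrite !ffunE.
Qed.

(** Otherwise [bin_shift_lower] with [u = t + 1 - n] gives [u n <= K (m + 1)]. But the lower bound
    on [t + 1], with [n / (n + 1) >= 1/2] and [n^2 <= m + 2], makes [u n] larger. *)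
Lemma order_maps_no_decay (n m t K : nat) :
  (0 < n)%N -> m.+2 = (n + n * n * (10 * n.+1))%N ->
  (t <= m)%N -> ((4 * K + 9) * m.+2 < t.+1 * (2 * n.+1))%N ->
  (K * 'C(m - t + n, n) < 'C(m.+1, n))%N.
Proof.
move=> n0 mE tm ht; rewrite ltnNge; apply/negP => H.
have nt : (n <= t.+1)%N by nia.
pose u := (t.+1 - n)%N; pose M' := (m - t + n)%N.
have uE : (M' + u = m.+1)%N by rewrite /u /M'; lia.
have := bin_shift_lower M' u n0; rewrite uE => H2.
have c1 : (0 < 'C(m.+1, n))%N.
  by rewrite bin_gt0 -ltnS mE -{1}[n]addn0 ltn_add2l !muln_gt0 n0.
have cM : (0 < 'C(M', n))%N.
  by rewrite lt0n; apply: contraTneq c1 => E0; rewrite -leqNgt (leq_trans H) // -/M' E0 muln0.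
have H3 : (M' + u * n <= K * M')%N.
  rewrite -(leq_pmul2l cM); apply: leq_trans H2 _.
  by rewrite mulnA leq_mul2r [('C(M', n) * K)%N]mulnC H orbT.
have H4 : (u * n <= K * m.+1)%N.
  apply: (leq_trans (leq_addl _ _) (leq_trans H3 _)).
  by rewrite leq_mul2l; apply/orP; right; lia.
have tE : t.+1 = (u + n)%N by rewrite /u; lia.
have H5 : ((4 * K + 9) * m.+2 * n < (u * n + n * n) * (2 * n.+1))%N.
  by rewrite -mulnDl -tE [(t.+1 * n * _)%N]mulnAC ltn_pmul2r.
have H6 : ((u * n + n * n) * (2 * n.+1) <= (K * m.+1 + n * n) * (4 * n))%N.
  by rewrite leq_mul ?leq_add2r //; lia.
have H7 : ((4 * K + 9) * m.+2 < (K * m.+1 + n * n) * 4)%N.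
  by rewrite -(ltn_pmul2r n0); apply: leq_trans H5 _; rewrite -mulnA.
have H8 : (n * n <= m.+2)%N by rewrite mE (leq_trans _ (leq_addl _ _)) // leq_pmulr.
have H9 : (K * m.+1 <= K * m.+2)%N by rewrite leq_mul2l leqnSn orbT.
lia.
Qed.

(** * The gap of the means across an up-set *)

(** The values at the points [iota i] bound those of an order map outside [B] from above and in [B]
    from below. If [b - a] were large, [order_maps_decay] would contradict [order_maps_no_decay]. *)
Lemma mean_gap_bound (R : realFieldType) (P : finType) (le : rel P)
    (I : finType) (iota : I -> P) (B : {set P}) (e : {ffun P -> nat}) (a b : R) :
  let L := injective_maps le #|P| in
  injective e -> monotone le e ->
  (forall x y, le x y -> x \in B -> y \in B) ->
  (forall x, x \notin B -> exists2 i, iota i \notin B & le x (iota i)) ->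
  (forall x, x \in B -> exists2 i, iota i \in B & le (iota i) x) ->
  0 <= a -> b <= #|P|.+1%:R ->
  (forall i, iota i \notin B -> (\sum_(f in L) (f (iota i)).+1)%:R <= a * #|L|%:R) ->
  (forall i, iota i \in B -> b * #|L|%:R <= (\sum_(f in L) (f (iota i)).+1)%:R) ->
  b - a < (4 * 3 ^ #|I| + 10)%:R.
Proof.
move=> L e_inj me upB maxA minB a0 bn hA hB; rewrite ltNge; apply/negP => H.
set K := (3 ^ #|I|)%N in H; set n := #|P| in bn *.
have nK : (4 * K + 9 <= n)%N by rewrite -(ler_nat R); move: H bn; rewrite -natr1 !natrD; lra.
have n0 : (0 < n)%N by lia.
(* With [w = n * (10 (n + 1))] this ensures [n w <= m + 2], as [bin_shift_upper] asks, and the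
   relative loss [(n - 1) / w] from [c2] to [c1] is below [1 / (10 (n + 1))]. *)
pose m := (n + n * n * (10 * n.+1) - 2)%N.
have mE : m.+2 = (n + n * n * (10 * n.+1))%N by rewrite /m; nia.
(* The largest [t] with [2 t (n + 1) <= (4 K + 9) (m + 2)]. As [4 K + 9 <= b - a - 1], there is room
   for the shift [2 t]. *)
pose t := ((4 * K + 9) * m.+2 %/ (2 * n.+1))%N.
have t1 : (t * (2 * n.+1) <= (4 * K + 9) * m.+2)%N by apply: leq_divM.
have t2 : ((4 * K + 9) * m.+2 < t.+1 * (2 * n.+1))%N by apply: ltn_ceil.
have [o1 o2 oS] := order_maps_estimates m e_inj me; rewrite -/L -/n in o1 o2 oS.
have Om0 := order_maps_gt0 le m.
have l0 : (0 < #|L|)%N.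
  by have := leq_trans Om0 o2; rewrite muln_gt0 => /andP[].
set c1 := 'C(m.+1, n) in o1 o2 oS; set c2 := 'C(m + n, n) in o1 o2 oS.
have c20 : (0 < c2)%N by rewrite bin_gt0 leq_addl.
have ratio : (1 - (10 * (n%:R + 1))^-1) * c2%:R <= c1%:R :> R.
  have r0 : 0 < 10 * (n%:R + 1) :> R by have := ler0n R n; lra.
  have h : (c2 * (n * (10 * n.+1) - n.-1) <= c1 * (n * (10 * n.+1)))%N.
    rewrite /c2 (_ : (m + n = m.+1 + n.-1)%N); last by lia.
    apply: bin_shift_upper; first by rewrite mE mulnA leq_addl.
    by rewrite (leq_trans (leq_pred n)) // leq_pmulr.
  have {}h : (c2 * (10 * n.+1 - 1) <= c1 * (10 * n.+1))%N.
    rewrite -(leq_pmul2l n0) [(n * (c1 * _))%N]mulnCA; apply: leq_trans h.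
    by rewrite mulnCA leq_mul2l mulnBr; apply/orP; right; lia.
  rewrite -(ler_pM2r r0) mulrAC mulrBl mulVf ?gt_eqF // mul1r mulrC.
  move: h; rewrite -(ler_nat R) !natrM natrB ?natrM -?natr1; last by lia.
  by rewrite /=; lra.
have natm2 : m.+2%:R = m%:R + 2 :> R by rewrite -addn2 natrD.
have natmn : (m + n).+1%:R = m%:R + n%:R + 1 :> R by rewrite -natr1 natrD.
have natn1 : n.+1%:R = n%:R + 1 :> R by rewrite -natr1.
have n1R : 1 <= n%:R :> R by rewrite ler1n.
have b0 : 0 <= b by have := ler0n R (4 * K + 10); lra.
pose upP (y : nat) := (n%:R + 1) * (1 - (10 * (n%:R + 1))^-1) * y%:R <= a * (m%:R + n%:R + 1).
pose loP (y : nat) := b * (m%:R + 2) * (1 - (10 * (n%:R + 1))^-1) <= (n%:R + 1) * (y%:R + 2).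
have key y z : upP y -> loP z -> (y + t.*2 <= z)%N.
  move=> hy hz; rewrite -(ler_nat R) natrD.
  apply: (separation_estimate n1R _ a0 _ _ _ hy hz).
  - by rewrite -natm2 mE natrD !natrM -natn1.
  - by move: H; rewrite natrD; have := ler0n R (4 * K); lra.
  - by rewrite -natn1.
  - rewrite -natn1 -natm2 -natrM; apply: (@le_trans _ _ ((4 * K + 9) * m.+2)%:R).
      by rewrite ler_nat -muln2 -mulnA.
    rewrite natrM ler_wpM2r //; move: H; rewrite !natrD; lra.
have t0 : 0 <= 1 - (10 * (n%:R + 1))^-1 :> R.
  by rewrite subr_ge0 invf_le1; lra.
(* The extreme values 0 and [m] satisfy the two bounds too, so [key] yields all three clauses of
   [separated_by], and [2 t <= m]. *)
have up0 : upP 0%N.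
  by rewrite /upP mulr0 mulr_ge0 //; have := ler0n R m; lra.
have lom : loP m.
  rewrite /loP -mulrA; apply: ler_pM => //; last 1 first.
  - by rewrite ler_piMr //; [have := ler0n R m; lra|rewrite gerBl invr_ge0; lra].
  - by rewrite mulr_ge0 //; have := ler0n R m; lra.
  - by rewrite -natn1.
have sumS x : (\sum_(X in order_maps le m) (X x).+1 =
    \sum_(X in order_maps le m) X x + #|order_maps le m|)%N.
  by rewrite -sum1_card -big_split /=; apply: eq_bigr => X _; rewrite addn1.
have tm : (t.*2 <= m)%N by apply: (key 0%N m).
have decay := @order_maps_decay P le I iota B m t tm upB.
have {}decay : (#|order_maps le m| <= K * #|order_maps le (m - t)|)%N.
  apply: decay => v hv X /monotoneP mX Xv.
  have upv i : iota i \notin B -> upP (v i).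
    move=> iB; have [_ hS] := oS (iota i); have [v1 _] := hv i.
    have c20' : 0 < c2%:R :> R by rewrite ltr0n.
    have l0' : 0 < #|L|%:R :> R by rewrite ltr0n.
    rewrite /upP -natmn -natn1.
    apply: (@mean_value_upper _ _ _ #|L|%:R c1%:R c2%:R #|order_maps le m|%:R
      (\sum_(X in order_maps le m) (X (iota i)).+1)%:R) (hA i iB); rewrite ?ler0n //.
    - by rewrite natn1.
    - by rewrite -natrM ler_nat.
    - by rewrite -natrM ler_nat sumS ltnW.
    - by rewrite -!natrM ler_nat.
  have lov i : iota i \in B -> loP (v i).
    move=> iB; have [hS _] := oS (iota i); have [_ v1] := hv i.
    have c20' : 0 < c2%:R :> R by rewrite ltr0n.
    have l0' : 0 < #|L|%:R :> R by rewrite ltr0n.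
    rewrite /loP -natm2 -natn1.
    apply: (@mean_value_lower _ _ _ #|L|%:R c1%:R c2%:R #|order_maps le m|%:R
      (\sum_(X in order_maps le m) (X (iota i)).+1)%:R) (hB i iB); rewrite ?ler0n //.
    - by rewrite natn1.
    - by rewrite -natrM ler_nat.
    - by rewrite -natrD -natrM ler_nat sumS addn2 mulnS [(_ + #|_|)%N]addnC leq_add2l ltnW.
    - by rewrite -!natrM ler_nat.
  have XA x : x \notin B -> exists2 y, upP y & (X x <= y)%N.
    by move=> /maxA[i iB xi]; exists (v i); [apply: upv|rewrite -Xv mX].
  have XB x : x \in B -> exists2 y, loP y & (y <= X x)%N.
    by move=> /minB[i iB xi]; exists (v i); [apply: lov|rewrite -Xv mX].
  split=> [x y _ /XA[p hp xp] /XB[q hq yq]|x /XB[q hq yq]|x /XA[p hp xp]].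
  - by apply: leq_trans (leq_trans _ (key _ _ hp hq)) yq; rewrite leq_add2r.
  - exact: leq_trans (key _ _ up0 hq) yq.
  - by apply: leq_trans (key _ _ hp lom); rewrite leq_add2r.
have tm' : (t <= m)%N by rewrite (leq_trans _ tm) // -addnn leq_addr.
have [_ o3 _] := order_maps_estimates (m - t) e_inj me; rewrite -/L -/n in o3.
have := order_maps_no_decay n0 mE tm' t2; rewrite -/c1 ltnNge => /negP; apply.
rewrite -(leq_pmul2l l0); apply: leq_trans o1 (leq_trans decay _).
by rewrite mulnCA leq_mul2l o3 orbT.
Qed.

(** * Maximal elements and differences of sorted sequences *)

(** Take [z] above [x] in [Q] with the most elements below it. With [r] abstract, the reversed order
    gives minimal elements. *)
Lemma exists_maximal (T : finType) (r : rel T) (Q : pred T) (x : T) :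
  reflexive r -> antisymmetric r -> transitive r -> Q x ->
  exists2 z, Q z && r x z & forall y, Q y -> r z y -> y = z.
Proof.
move=> rr ra rt Qx; have Qxx : Q x && r x x by rewrite Qx rr.
case: (@arg_maxnP _ x (fun z => Q z && r x z) (fun z => #|[set y | r y z]|) Qxx) => z Qz zmax.
exists z => // y Qy zy; apply/eqP; apply: contraT => yz.
have : (#|[set u | r u y]| <= #|[set u | r u z]|)%N.
  by apply: zmax; rewrite Qy (rt z) //; case/andP: Qz.
rewrite leqNgt => /negP; case; apply/proper_card/properP; split.
  by apply/subsetP => u; rewrite !inE => /rt; apply.
exists y; rewrite ?inE ?rr //; apply: contra yz => yz.
by apply/eqP/ra; rewrite yz.
Qed.

Lemma pairmap_gap (R : realDomainType) (x0 : R) (s : seq R) (g : R) :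
  path <=%R x0 s -> g \in pairmap (fun a b => b - a) x0 s ->
  exists a b, [/\ x0 <= a, b <= last x0 s, b - a = g &
                  forall y, y \in s -> y <= a \/ b <= y].
Proof.
elim: s x0 => //= x s IH x0 /andP[x0x xs]; rewrite inE => /predU1P[->|gs].
  exists x0, x; have /andP[mins _] : all (<=%R x) s && sorted <=%R s.
    by rewrite -(path_sortedE le_trans).
  have xl : forall y, y \in x :: s -> x <= y.
    by move=> y; rewrite inE => /predU1P[-> //|/(allP mins)].
  by split=> //; [apply/xl/mem_last|move=> y /xl; right].
have [a [b [xa bl ab ys]]] := IH _ xs gs; exists a, b; split=> //.
  exact: le_trans xa.
by move=> y; rewrite inE => /predU1P[->|/ys //]; left.
Qed.

(** Positivity of [N] excludes the initial value 0 of the maximum. *)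
Lemma bigmax_ge (R : realDomainType) (s : seq R) (N : R) :
  0 < N -> N <= \big[Num.max/0]_(g <- s) g -> exists2 g, g \in s & N <= g.
Proof.
move=> N0; elim: s => [|x s IH]; first by rewrite big_nil leNgt N0.
rewrite big_cons le_max => /orP[h|/IH[g gs h]].
  by exists x; rewrite ?inE ?eqxx.
by exists g; rewrite ?inE ?gs ?orbT.
Qed.

(** * Heights, gap and width of a poset *)

Section Heights.
Variables (d : Order.disp_t) (P : finPOrderType d) (R : realType).

Let leP : rel P := fun x y => (x <= y)%O.

(** The size of the principal down-set is strictly increasing; [enum_rank], below [#|P|], breaks
    ties. *)
Lemma exists_injective_monotone :
  exists2 e : {ffun P -> nat}, injective e & monotone leP e.
Proof.
pose D (x : P) := [set y : P | (y <= x)%O].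
exists [ffun x => (#|D x| * #|P| + enum_rank x)%N].
  move=> x y; rewrite !ffunE => /(congr1 (modn^~ #|P|)).
  by rewrite !modnMDl !modn_small // => /val_inj/enum_rank_inj.
apply/monotoneP => x y xy; rewrite !ffunE.
have [->//|xney] := eqVneq x y.
have : (#|D x| < #|D y|)%N.
  apply/proper_card/properP; split.
    by apply/subsetP => z; rewrite !inE => /le_trans; apply.
  exists y; rewrite ?inE //; apply: contra xney => yx.
  by rewrite eq_le yx andbT.
move=> lt; apply: (@leq_trans (#|D x|.+1 * #|P|)).
  by rewrite mulSn addnC leq_add2r ltnW.
by rewrite (leq_trans (leq_mul lt (leqnn _))) // leq_addr.
Qed.

Lemma linear_extensionsE : linear_extensions P = injective_maps leP #|P|.
Proof.
apply/setP => f; rewrite !inE; congr (_ && _).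
apply/forallP/monotoneP => [h x y xy|h x].
  by rewrite !ffunE; move: (h x) => /forallP/(_ y)/implyP; apply.
by apply/forallP => y; apply/implyP => /h; rewrite !ffunE.
Qed.

(** The constant map is an order map, and the upper estimate of their number has this cardinal as a
    factor. *)
Lemma linear_extensions_gt0 : (0 < #|linear_extensions P|)%N.
Proof.
have [e e_inj me] := exists_injective_monotone.
have [_ h _] := order_maps_estimates 0 e_inj me.
by have := leq_trans (order_maps_gt0 leP 0) h; rewrite -linear_extensionsE muln_gt0 => /andP[].
Qed.

Lemma heightE (x : P) :
  height R x = (\sum_(f in linear_extensions P) (f x).+1)%:R / #|linear_extensions P|%:R.
Proof. by rewrite /height natr_sum. Qed.

Lemma height_le (x : P) (a : R) : (height R x <= a) =
  ((\sum_(f in linear_extensions P) (f x).+1)%:R <= a * #|linear_extensions P|%:R).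
Proof. by rewrite heightE ler_pdivrMr // ltr0n linear_extensions_gt0. Qed.

Lemma height_ge (x : P) (b : R) : (b <= height R x) =
  (b * #|linear_extensions P|%:R <= (\sum_(f in linear_extensions P) (f x).+1)%:R).
Proof. by rewrite heightE ler_pdivlMr // ltr0n linear_extensions_gt0. Qed.

Lemma height_ge0 (x : P) : 0 <= height R x.
Proof. by rewrite height_ge mul0r. Qed.

Lemma height_bound (x : P) : height R x <= #|P|.+1%:R.
Proof.
rewrite height_le -natrM ler_nat mulnC -sum_nat_const; apply: leq_sum => f _.
by rewrite ltnS ltnW.
Qed.

Lemma height_mono (x y : P) : (x <= y)%O -> height R x <= height R y.
Proof.
move=> xy; rewrite height_le {1}heightE divfK; last first.
  by rewrite pnatr_eq0 -lt0n linear_extensions_gt0.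
rewrite ler_nat; apply: leq_sum => f; rewrite inE => /andP[_ /forallP/(_ x)].
by move=> /forallP/(_ y)/implyP/(_ xy).
Qed.

Lemma gap_split (N : R) : 0 < N -> N <= gap P R ->
  exists a b : R, [/\ 0 <= a, b <= #|P|.+1%:R, N <= b - a &
                      forall x : P, height R x <= a \/ b <= height R x].
Proof.
move=> N0 /(bigmax_ge N0)[g gin Ng].
have sp : path <=%R 0 (rcons [seq height R x | x <- by_height P R] #|P|.+1%:R).
  rewrite rcons_path path_min_sorted.
    apply/andP; split.
      by rewrite sorted_map sort_sorted // => x y; apply: le_total.
    have := mem_last 0 [seq height R x | x <- by_height P R].
    by rewrite inE => /predU1P[->|/mapP[x _ ->]]; [apply: ler0n|apply: height_bound].
  by apply/allP => _ /mapP[x _ ->]; apply: height_ge0.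
have [a [b [a0 bl ab hs]]] := pairmap_gap sp gin; exists a, b; split=> //.
- by rewrite last_rcons in bl.
- by rewrite ab.
move=> x; apply: hs; rewrite mem_rcons inE map_f ?orbT //.
by rewrite mem_sort mem_enum.
Qed.

Lemma antichain_width (A : {set P}) : antichain A -> (#|A| <= width P)%N.
Proof. exact: (@leq_bigmax_cond _ (@antichain d P) (fun A : {set P} => #|A|) A). Qed.

Lemma gap_width_bound (N : R) : N <= gap P R -> (4 * 3 ^ (2 * width P) + 10)%:R <= N -> False.
Proof.
move=> gN hN.
have N0 : 0 < N by apply: lt_le_trans hN; rewrite ltr0n addn_gt0 orbT.
have [a [b [a0 bn ab hs]]] := gap_split N0 gN.
have lt_ab : a < b by rewrite -subr_gt0 (lt_le_trans N0).
pose B := [set x : P | b <= height R x].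
have hB (x : P) : x \notin B -> height R x <= a.
  by rewrite inE; case: (hs x) => // ->.
pose mA := [set x : P | (x \notin B) &&
  [forall y : P, (y \notin B) ==> (x <= y)%O ==> (y == x)]].
pose mB := [set x : P | (x \in B) &&
  [forall y : P, (y \in B) ==> (y <= x)%O ==> (y == x)]].
have anti_mA : antichain mA.
  apply/forallP => x; apply/implyP; rewrite inE => /andP[xB /forallP mx].
  apply/forallP => y; apply/implyP; rewrite inE => /andP[yB /forallP my].
  apply/implyP => /orP[xy|yx].
    by rewrite eq_sym; move: (mx y); rewrite yB xy.
  by move: (my x); rewrite xB yx.
have anti_mB : antichain mB.
  apply/forallP => x; apply/implyP; rewrite inE => /andP[xB /forallP mx].
  apply/forallP => y; apply/implyP; rewrite inE => /andP[yB /forallP my].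
  apply/implyP => /orP[xy|yx].
    by move: (my x); rewrite xB xy.
  by rewrite eq_sym; move: (mx y); rewrite yB yx.
(* A union of two antichains, whence the exponent [2 * width P]. *)
pose S := mA :|: mB; pose I : finType := {x : P | x \in S}.
have cardI : (#|I| <= 2 * width P)%N.
  rewrite card_sig (leq_trans (eq_leq (eq_card (_ : _ =i S)))) //.
  rewrite (leq_trans (leq_card_setU _ _)) // mul2n -addnn leq_add //; exact: antichain_width.
have [e e_inj me] := exists_injective_monotone.
have : b - a < (4 * 3 ^ #|I| + 10)%:R.
  apply: (mean_gap_bound (iota := val : I -> P) (B := B) e_inj me) => //.
  - by move=> x y xy; rewrite !inE => /le_trans; apply; apply: height_mono.
  - move=> x xB.
    have [z /andP[zB xz] zmax] :=
      @exists_maximal P leP [pred y | y \notin B] x lexx le_anti le_trans xB.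
    have zS : z \in S.
      apply/setUP; left; rewrite inE; apply/andP; split=> //; apply/forallP => y.
      by apply/implyP => yB; apply/implyP => zy; apply/eqP/zmax.
    by exists (exist _ z zS).
  - move=> x xB.
    have [z /andP[zB xz] zmin] :=
      @exists_maximal P (fun u v => leP v u) [pred y | y \in B] x lexx ge_anti ge_trans xB.
    have zS : z \in S.
      apply/setUP; right; rewrite inE; apply/andP; split=> //; apply/forallP => y.
      by apply/implyP => yB; apply/implyP => zy; apply/eqP/zmin.
    by exists (exist _ z zS).
  - by move=> i iB; rewrite -linear_extensionsE -height_le hB.
  - by move=> i iB; rewrite -linear_extensionsE -height_ge; rewrite inE in iB.
rewrite ltNge => /negP; apply; apply: le_trans ab; apply: le_trans hN.
by rewrite ler_nat leq_add2r leq_mul2l leq_pexp2l.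
Qed.

End Heights.

Theorem theorem2p3 (R : realType) (M : R) (M_gt0 : 0 < M) :
  exists N : R, forall (d : Order.disp_t) (P : finPOrderType d),
    N <= gap P R -> M <= (width P)%:R.
Proof.
(* If the width were below [M], it would be below [Num.bound M], and [gap_width_bound] would
   apply. *)
exists (4 * 3 ^ (2 * Num.bound M) + 10)%:R => d P gN.
rewrite leNgt; apply/negP => wM; apply: (gap_width_bound gN).
rewrite ler_nat leq_add2r leq_mul2l leq_pexp2l // leq_mul2l /= -(ler_nat R).
by apply: ltW; apply: lt_trans wM (archi_boundP _); apply: ltW.
Qed.
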